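(* Let $q$ be a power of an odd prime, let $n\ge 2$, and let $\mathcal{K}\subset \mathbb{F}_q^n$ be a set containing at least $q-1$ distinct spheres if $n\ge 4$, or at least $(q-1)/2$ distinct spheres if $n\in\{2,3\}$. Then $$|\mathcal{K}| \geq \begin{cases}\frac{1}{2}q^n + \frac{1}{2}q^{n-1} - q^{n-2} - \frac{1}{2}q^{\lfloor \frac{n-1}{2}\rfloor + 2} + \frac{1}{2} q^{\lfloor \frac{n-1}{2}\rfloor + 1}, & n \geq 4, \\[4pt] \dfrac{q^n-q^{n-2}}{4}, & n = 2,3. \end{cases}$$
   Context: $\mathbb{F}_q$ is the finite field with $q$ elements and $\mathbb{F}_q^*=\mathbb{F}_q\setminus\{0\}$. For $\underline{x}=(x_1,\ldots,x_n)\in\mathbb{F}_q^n$ put $\|\underline{x}\|=x_1^2+\cdots+x_n^2\in\mathbb{F}_q$. A sphere in $\mathbb{F}_q^n$ is a set of the form $\mathcal{S}_r(\underline{a})=\{\underline{x}\in\mathbb{F}_q^n : \|\underline{x}-\underline{a}\|=r\}$ with center $\underline{a}\in\mathbb{F}_q^n$ and radius $r\in\mathbb{F}_q^*$ (the radius is always nonzero). *)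

(* Defs.v *)
From HB Require Import structures.
From mathcomp Require Import all_boot all_order all_algebra all_field.

Set Implicit Arguments.
Unset Strict Implicit.
Unset Printing Implicit Defensive.

Import Order.TTheory GRing.Theory Num.Theory.

Local Open Scope ring_scope.

(* Takes values in the field itself: there is no square root and no order. *)
Definition sqnorm (F : finFieldType) (n : nat) (x : 'rV[F]_n) : F :=
  \sum_(i < n) x 0 i ^+ 2.

Definition sphere (F : finFieldType) (n : nat) (a : 'rV[F]_n) (r : F) :
    {set 'rV[F]_n} :=
  [set x | sqnorm (x - a) == r].

Definition is_sphere (F : finFieldType) (n : nat) (S : {set 'rV[F]_n}) : bool :=
  [exists a : 'rV[F]_n, exists r : F, (r != 0) && (S == sphere a r)].

(* Spheres are counted as subsets of the space, not as pairs (center, radius). *)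
Definition spheres_in (F : finFieldType) (n : nat) (K : {set 'rV[F]_n}) :
    {set {set 'rV[F]_n}} :=
  [set S | is_sphere S & S \subset K].

(* Main.v *)
Require Import Defs.
From HB Require Import structures.
From mathcomp Require Import all_boot all_order all_algebra all_field.
From mathcomp Require Import ring lra zify.

Set Implicit Arguments.
Unset Strict Implicit.
Unset Printing Implicit Defensive.

Import Order.TTheory GRing.Theory Num.Theory.

Local Open Scope ring_scope.

(* The union of m spheres is bounded below by its first two Bonferroni sums.
   With f = (n - 1) / 2 rounded down, a sphere has at least q^(n-1) - q^f points
   and two distinct spheres share at most q^(n-2) + q^f, and for m = q - 1 or
   m = (q - 1) / 2 these bounds add up exactly to the required value.

   For e = 1 or e = -1, x^2 + y^2 = t has q - e solutions if t is nonzero and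
   q - e + q e solutions if t = 0, so splitting off two coordinates multiplies
   the error |S_r| - q^(n-1) by q e. Two spheres meet in the section of one of
   them by a hyperplane with normal vector v. If v is isotropic, translation
   by v counts the sections; otherwise one translates by the isotropic vector
   (v, 1) of the form |x| - |v| l^2. *)

(** * Indicator sums and counting by translation *)

Lemma natr_card (T : finType) (A : {pred T}) :
  #|A|%:R = \sum_x (x \in A)%:R :> rat.
Proof.
rewrite -sum1_card natr_sum big_mkcond /=.
by apply: eq_bigr => x _; case: (x \in A).
Qed.

Lemma sum_pred1 (T : finType) (u : T) : \sum_s (s == u)%:R = 1 :> rat.
Proof.
rewrite (bigD1 u) //= eqxx big1 ?addr0 // => s /negbTE -> //.
Qed.

Lemma sum_affine (F : finFieldType) (a b t : F) :
  a != 0 -> \sum_s (s * a + b == t)%:R = 1 :> rat.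
Proof.
move=> a0; rewrite -[RHS](sum_pred1 ((t - b) / a)); apply: eq_bigr => s _.
by congr (_ *+ nat_of_bool _); apply/eqP/eqP => [<-|->]; field.
Qed.

(** Double counting of pairs [(s, x)]: each [sh s] permutes the points of [P], and from each such
    point exactly one parameter [s] leads into [R]. *)
Lemma shift_count (T I : finType) (sh : I -> T -> T) (P R : pred T) :
  (forall s, injective (sh s)) -> (forall s x, P (sh s x) = P x) ->
  (forall x, P x -> \sum_s (R (sh s x))%:R = 1 :> rat) ->
  #|I|%:R * (\sum_x (P x && R x)%:R) = \sum_x (P x)%:R :> rat.
Proof.
move=> injsh Psh R1; rewrite mulr_natl -sumr_const.
under eq_bigr => s _ do rewrite (reindex_inj (injsh s)).
rewrite exchange_big; apply: eq_bigr => x _.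
under eq_bigr => s _ do rewrite Psh.
by case: (boolP (P x)) => Px /=; [exact: R1 | rewrite big1].
Qed.

Section OddField.
Variable F : finFieldType.
Hypothesis two : 2 != 0 :> F.
Local Notation q := (#|F|%:R : rat).

Lemma q_gt0 : 0 < q.
Proof. by rewrite ltr0n; apply/card_gt0P; exists 0. Qed.

Lemma sum_one : \sum_(x : F) 1 = q.
Proof. by rewrite sumr_const. Qed.

(** * Square roots and plane conics in odd characteristic *)

Definition square_count (u : F) : rat := \sum_(x : F) (x ^+ 2 == u)%:R.

Lemma square_count0 : square_count 0 = 1.
Proof.
rewrite /square_count -[RHS](sum_pred1 (0 : F)).
by apply: eq_bigr => x _; rewrite expf_eq0.
Qed.

Lemma square_count_ge0 u : 0 <= square_count u.
Proof. by apply: sumr_ge0 => x _; apply: ler0n. Qed.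

Lemma square_count_nonsquare u : (forall x, x ^+ 2 != u) -> square_count u = 0.
Proof. by move=> nu; apply: big1 => x _; rewrite (negbTE (nu x)). Qed.

Lemma square_count_le2 u : square_count u <= 2.
Proof.
case: (pickP (fun x : F => x ^+ 2 == u)) => [y /eqP <-|nu]; last first.
  by rewrite square_count_nonsquare ?ler0n // => x; rewrite nu.
apply: (@le_trans _ _ (\sum_(x : F) ((x == y)%:R + (x == - y)%:R))).
  apply: ler_sum => x _; rewrite eqf_sqr.
  by case: (x == y); case: (x == - y).
by rewrite big_split /= !sum_pred1.
Qed.

Lemma sum_square_count : \sum_u square_count u = q.
Proof.
rewrite exchange_big -sum_one; apply: eq_bigr => x _.
under eq_bigr => u _ do rewrite eq_sym.
exact: sum_pred1.
Qed.

(** If [-1] is not a square, [u] and [- u] cannot both be nonzero squares, so the sum is at most 2.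
    Its average over [u] is exactly 2, which forces equality everywhere. *)
Lemma square_countN : (forall i : F, i ^+ 2 != -1) ->
  forall u, square_count u + square_count (- u) = 2.
Proof.
move=> ni.
have le2 u : square_count u + square_count (- u) <= 2.
  have [->|u0] := eqVneq u 0; first by rewrite oppr0 square_count0.
  case: (pickP (fun x : F => x ^+ 2 == u)) => [y /eqP y2|nu]; last first.
    rewrite square_count_nonsquare ?add0r ?square_count_le2 // => x.
    by rewrite nu.
  rewrite [square_count (- u)]square_count_nonsquare ?addr0 ?square_count_le2 //.
  move=> x; apply/eqP => x2; move: (ni (x / y)).
  by rewrite expr_div_n x2 y2 mulNr divff // eqxx.
have sum0 : \sum_u (2 - (square_count u + square_count (- u))) = 0.
  have sumN : \sum_u square_count (- u) = q.
    by rewrite -sum_square_count [RHS](reindex_inj (@oppr_inj F)).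
  by rewrite sumrB sumr_const big_split /= sum_square_count sumN -mulr_natr; ring.
move=> u; apply/esym/eqP; rewrite -subr_eq0; apply/eqP.
have := psumr_eq0P _ sum0; apply=> // v _.
by rewrite subr_ge0.
Qed.

(** Substituting [x = s + y] turns [x ^+ 2 - y ^+ 2] into [2 * s * y + s ^+ 2], which is affine in
    [y] with nonzero slope unless [s = 0]. *)
Lemma hyperbola_count (t : F) :
  \sum_(x : F) \sum_(y : F) (x ^+ 2 - y ^+ 2 == t)%:R
    = q - 1 + q * (t == 0)%:R :> rat.
Proof.
rewrite exchange_big /=.
under eq_bigr => y _ do rewrite (reindex_inj (addIr y)) /=.
rewrite exchange_big /= (bigD1 0) //=.
have -> : \sum_(i : F) ((0 + i) ^+ 2 - i ^+ 2 == t)%:R = q * (t == 0)%:R :> rat.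
  under eq_bigr => i _ do rewrite add0r subrr eq_sym.
  by rewrite sumr_const mulr_natl.
rewrite (eq_bigr (fun=> 1)) => [|s s0].
  rewrite addrC; congr (_ + _).
  have := sum_one; rewrite (bigD1 0) //= => <-; ring.
rewrite -[RHS](@sum_affine F (2 * s) (s ^+ 2) t) ?mulf_neq0 //.
by apply: eq_bigr => y _; congr (_ *+ nat_of_bool (_ == _)); ring.
Qed.

(** Here [e] is the quadratic character of [-1]. A square root [i] of [-1] turns the circle into a
    hyperbola; without one, circle and hyperbola counts are complementary. *)
Lemma circle_count : exists2 e : rat, e = 1 \/ e = -1 & forall t : F,
  \sum_(x : F) \sum_(y : F) (x ^+ 2 + y ^+ 2 == t)%:R
    = q - e + q * e * (t == 0)%:R.
Proof.
case: (pickP (fun i : F => i ^+ 2 == -1)) => [i /eqP i2|ni].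
  exists 1; first by left.
  have i0 : i != 0.
    by apply/eqP => i0; move/eqP: i2; rewrite i0 expr0n eq_sym oppr_eq0 oner_eq0.
  move=> t; rewrite mulr1 -hyperbola_count; apply: eq_bigr => x _.
  rewrite (reindex_inj (mulfI i0)); apply: eq_bigr => y _.
  by rewrite exprMn i2 mulN1r.
have {}ni (i : F) : i ^+ 2 != -1 by apply/negbT/ni.
exists (-1); first by right.
move=> t; have := hyperbola_count (- t).
rewrite oppr_eq0 => H.
(* For fixed y, the two counts add up to 2 by [square_countN]. *)
suff : \sum_x \sum_y (x ^+ 2 + y ^+ 2 == t)%:R
   + \sum_x \sum_y (x ^+ 2 - y ^+ 2 == - t)%:R = 2 * q :> rat.
  rewrite H; set b := (t == 0)%:R => H2; nra.
rewrite exchange_big [X in _ + X]exchange_big -big_split /=.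
rewrite mulrC mulr_natl -sumr_const.
apply: eq_bigr => y _; rewrite -(square_countN ni (t - y ^+ 2)).
congr (_ + _); apply: eq_bigr => x _; congr (_ *+ nat_of_bool _).
  by rewrite eq_sym -subr_eq eq_sym.
by rewrite opprB [LHS]eq_sym -[LHS]subr_eq opprK addrC eq_sym.
Qed.


(** * Point counts of spheres and their error terms *)

Definition sphere_count n (t : F) : rat :=
  \sum_(x : 'rV[F]_n) (sqnorm x == t)%:R.

(** The index is one less than the dimension, so that the main term [q ^+ n] needs no subtraction in
    the exponent. *)
Definition sphere_err n (t : F) : rat := sphere_count n.+1 t - q ^+ n.

Lemma sum_row_mx m n (f : 'rV[F]_(m + n) -> rat) :
  \sum_x f x = \sum_(u : 'rV_m) \sum_(v : 'rV_n) f (row_mx u v).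
Proof.
rewrite pair_big /= (reindex (fun p : 'rV_m * 'rV_n => row_mx p.1 p.2)) //.
exists (fun x => (lsubmx x, rsubmx x)) => [[u v] _|x _] /=.
  by rewrite row_mxKl row_mxKr.
exact: hsubmxK.
Qed.

Lemma sum_row1 (f : 'rV[F]_1 -> rat) : \sum_u f u = \sum_a f (const_mx a).
Proof.
rewrite (reindex (fun a : F => const_mx a : 'rV_1)) //.
exists (fun u : 'rV_1 => u 0 0) => [a _|u _]; first by rewrite mxE.
by apply/rowP => j; rewrite !mxE (ord1 j).
Qed.

Lemma sqnorm_row_mx m n (u : 'rV[F]_m) (v : 'rV[F]_n) :
  sqnorm (row_mx u v) = sqnorm u + sqnorm v.
Proof.
rewrite /sqnorm big_split_ord; congr (_ + _); apply: eq_bigr => i _.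
  by rewrite row_mxEl.
by rewrite row_mxEr.
Qed.

Lemma sqnorm_const1 (a : F) : sqnorm (const_mx a : 'rV_1) = a ^+ 2.
Proof. by rewrite /sqnorm big_ord1 mxE. Qed.

Lemma sphere_countS n t :
  sphere_count n.+1 t = \sum_(a : F) sphere_count n (t - a ^+ 2).
Proof.
rewrite /sphere_count (@sum_row_mx 1 n) sum_row1; apply: eq_bigr => a _.
apply: eq_bigr => v _; rewrite (@sqnorm_row_mx 1 n) sqnorm_const1.
by rewrite addrC eq_sym -subr_eq eq_sym.
Qed.

Lemma sphere_count0 t : sphere_count 0 t = (t == 0)%:R.
Proof.
rewrite /sphere_count (eq_bigr (fun=> (t == 0)%:R)) => [|x _].
  by rewrite sumr_const card_mx muln0 expn0.
by rewrite /sqnorm big_ord0 eq_sym.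
Qed.

Lemma sphere_count1 t : sphere_count 1 t = square_count t.
Proof.
rewrite sphere_countS; apply: eq_bigr => a _.
by rewrite sphere_count0 subr_eq0 eq_sym.
Qed.

Lemma sum_rV_one n : \sum_(x : 'rV[F]_n) 1 = q ^+ n.
Proof. by rewrite sumr_const card_mx mul1n natrX. Qed.

Lemma sphere_countSS n t : sphere_count n.+2 t =
  \sum_(z : 'rV[F]_n) \sum_a \sum_b (a ^+ 2 + b ^+ 2 == t - sqnorm z)%:R.
Proof.
rewrite exchange_big sphere_countS; apply: eq_bigr => a _.
rewrite exchange_big sphere_countS; apply: eq_bigr => b _.
apply: eq_bigr => z _; congr (_ *+ nat_of_bool _).
by apply/eqP/eqP => [->|H]; [ring | rewrite -[sqnorm z](subKr t) -H; ring].
Qed.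

(* The error terms of two consecutive spheres of equal parity are proportional,
   with factor of absolute value q. *)
Lemma sphere_errSS : exists2 e : rat, e = 1 \/ e = -1 &
  (forall t, sphere_err 1 t = - e + q * e * (t == 0)%:R) /\
  forall n t, sphere_err n.+2 t = q * e * sphere_err n t.
Proof.
have [e e1 circ] := circle_count.
have rec n t : sphere_count n.+2 t = (q - e) * q ^+ n + q * e * sphere_count n t.
  rewrite sphere_countSS; under eq_bigr => z _ do rewrite circ.
  rewrite big_split /= sumr_const card_mx mul1n -[X in X + _]mulr_natr natrX.
  congr (_ + _).
  rewrite -mulr_sumr; congr (_ * _); apply: eq_bigr => z _.
  by rewrite subr_eq0 eq_sym.
exists e => //; split=> [t|n t].
  by rewrite /sphere_err rec sphere_count0 expr0 expr1; ring.
by rewrite /sphere_err rec !exprS; ring.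
Qed.

(* The sum over l is bounded separately because [e 0] may be as large as
   [(q - 1) * B]; cancellation against the other terms compensates for it. *)
Definition small_err (B : rat) (e : F -> rat) :=
  (forall t, t != 0 -> `|e t| <= B) /\
  forall d t, d != 0 -> `|\sum_l e (t + d * l ^+ 2)| <= q * B.

Lemma small_err_scale B (c : rat) e e' :
  (forall t, e' t = c * e t) -> small_err B e -> small_err (`|c| * B) e'.
Proof.
move=> e'E [e1 e2]; split=> [t t0|d t d0].
  by rewrite e'E normrM ler_wpM2l // e1.
under eq_bigr => l _ do rewrite e'E.
by rewrite -mulr_sumr normrM mulrCA ler_wpM2l // e2.
Qed.

(** The recursion moves two dimensions at a time, so the induction carries two consecutive indices,
    with base cases in dimensions 1 and 2. *)
Lemma small_sphere_err n : small_err (q ^+ (n %/ 2)) (sphere_err n).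
Proof.
have q0 := q_gt0.
have [e e1 [err1 errSS]] := sphere_errSS.
have ne : `|e| = 1 by case: e1 => ->; rewrite ?normrN normr1.
suff [] : small_err (q ^+ (n %/ 2)) (sphere_err n) /\
          small_err (q ^+ (n.+1 %/ 2)) (sphere_err n.+1) by [].
elim: n => [|n [IH0 IH1]]; last first.
  split=> //; rewrite (_ : n.+2 %/ 2 = (n %/ 2).+1)%N; last by lia.
  rewrite exprS -[X in X * _](_ : `|q * e| = q); last first.
    by rewrite normrM ne mulr1 gtr0_norm.
  exact: small_err_scale (errSS n) IH0.
split.
  have le1 t : `|sphere_err 0 t| <= 1.
    rewrite /sphere_err sphere_count1 expr0 ler_norml.
    have := square_count_ge0 t; have := square_count_le2 t; lra.
  split=> // d t _; apply: le_trans (ler_norm_sum _ _ _) _.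
  by rewrite mulr1 -sum_one; apply: ler_sum.
split=> [t /negbTE t0|d t d0].
  by rewrite err1 t0 mulr0 addr0 normrN ne.
under eq_bigr => l _ do rewrite err1.
rewrite big_split /= sumr_const -mulr_sumr.
(* The large error at 0 is met once for each square root of [- t / d]. The total is then [q * e]
   times a number between -1 and 1. *)
have -> : \sum_l (t + d * l ^+ 2 == 0)%:R = square_count (- t / d).
  apply: eq_bigr => l _; congr (_ *+ nat_of_bool _).
  by apply/eqP/eqP => [H|->]; [rewrite (addr0_eq H) | ]; field.
rewrite -[X in X + _]mulr_natr.
rewrite (_ : - e * q + _ = q * e * (square_count (- t / d) - 1)); last by ring.
rewrite !normrM ne mulr1 (gtr0_norm q0) ler_pM2l // ler_norml.
have := square_count_ge0 (- t / d); have := square_count_le2 (- t / d); lra.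
Qed.

(** * Hyperplane sections of spheres *)

Definition dot n (v x : 'rV[F]_n) : F := \sum_i v 0 i * x 0 i.

Lemma dot_shift n (u x v : 'rV[F]_n) s :
  dot u (x + s *: v) = dot u x + s * dot u v.
Proof.
rewrite /dot mulr_sumr -big_split; apply: eq_bigr => i _ /=.
by rewrite !mxE; ring.
Qed.

Lemma sqnorm_shift n (x v : 'rV[F]_n) s :
  sqnorm (x + s *: v) = sqnorm x + 2 * s * dot v x + s ^+ 2 * sqnorm v.
Proof.
rewrite /sqnorm /dot !mulr_sumr -!big_split; apply: eq_bigr => i _ /=.
by rewrite !mxE; ring.
Qed.

Lemma dot_diag n (v : 'rV[F]_n) : dot v v = sqnorm v.
Proof. by apply: eq_bigr => i _; rewrite expr2. Qed.

Lemma hyperplane_count n (v : 'rV[F]_n) c : v != 0 ->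
  q * (\sum_x (dot v x == c)%:R) = q ^+ n.
Proof.
move=> /rV0Pn [j vj]; rewrite -sum_rV_one.
rewrite -(@shift_count _ F (fun s x => x + s *: delta_mx 0 j) predT
    (fun x => dot v x == c)) //.
  by move=> s; apply: addIr.
move=> x _; rewrite -[RHS](sum_affine (dot v x) c vj); apply: eq_bigr => s _.
congr (_ *+ nat_of_bool (_ == _)); rewrite dot_shift addrC; congr (_ * _ + _).
rewrite /dot (bigD1 j) //= big1 => [|i ij].
  by rewrite mxE !eqxx mulr1 addr0.
by rewrite mxE (negbTE ij) andbF mulr0.
Qed.

Definition section_count n (v : 'rV[F]_n) r c : rat :=
  \sum_x ((dot v x == c) && (sqnorm x == r))%:R.

Lemma sum_section_count n (v : 'rV[F]_n) r :
  \sum_c section_count v r c = sphere_count n r.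
Proof.
rewrite exchange_big; apply: eq_bigr => x _ /=.
rewrite (bigD1 (dot v x)) //= eqxx big1 ?addr0 // => c.
by rewrite eq_sym => /negbTE ->.
Qed.

(** Translation by [s *: v] stays in the hyperplane because [v] is isotropic, and adds [2 * s * c]
    to the norm. So each norm takes an equal share of the hyperplane. *)
Lemma section_count_isotropic_neq0 n (v : 'rV[F]_n.+2) r c :
  v != 0 -> sqnorm v = 0 -> c != 0 -> section_count v r c = q ^+ n.
Proof.
move=> v0 nv c0; have q0 := q_gt0.
have qq : q * (q * section_count v r c) = q ^+ n.+2.
  rewrite -(hyperplane_count c v0); congr (_ * _).
  apply: (@shift_count _ _ (fun s x => x + s *: v)
    (fun x => dot v x == c) (fun x => sqnorm x == r)).
  - by move=> s; apply: addIr.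
  - by move=> s x; rewrite dot_shift dot_diag nv mulr0 addr0.
  move=> x /eqP vx.
  rewrite -[RHS](@sum_affine F (2 * c) (sqnorm x) r) ?mulf_neq0 //.
  apply: eq_bigr => s _; congr (_ *+ nat_of_bool (_ == _)).
  by rewrite sqnorm_shift vx nv; ring.
apply: (mulfI (lt0r_neq0 q0)); apply: (mulfI (lt0r_neq0 q0)).
by rewrite qq !exprS.
Qed.

(** The parallel sections partition the sphere and all others have exactly [q ^+ n] points, so this
    one absorbs the whole error of the sphere. *)
Lemma section_count_isotropic0 n (v : 'rV[F]_n.+2) r :
  v != 0 -> sqnorm v = 0 -> section_count v r 0 = q ^+ n + sphere_err n.+1 r.
Proof.
move=> v0 nv; rewrite /sphere_err -(sum_section_count v) (bigD1 0) //=.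
rewrite (eq_bigr (fun=> q ^+ n)) => [|c c0]; last first.
  by apply: section_count_isotropic_neq0.
have : \sum_(c : F) q ^+ n = q ^+ n.+1.
  by rewrite sumr_const -[LHS]mulr_natl exprS.
by rewrite (bigD1 0) //= => <-; ring.
Qed.

(* The form [sqnorm x - sqnorm v * l ^+ 2] on pairs [(x, l)] has the isotropic
   vector [(v, 1)], so its level sets are counted by translating along it. *)
Lemma section_count_anisotropic n (v : 'rV[F]_n.+1) r c :
  sqnorm v != 0 ->
  q * section_count v r c = q ^+ n +
    \sum_l sphere_err n (r - c ^+ 2 / sqnorm v + sqnorm v * l ^+ 2).
Proof.
(* On the hyperplane [dot v x = c], the condition [sqnorm x = r] says that the part of [x]
   orthogonal to [v] has norm [t]. *)
set d := sqnorm v => d0; set t := r - c ^+ 2 / d.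
have q0 := q_gt0.
pose Q (p : 'rV[F]_n.+1 * F) := sqnorm p.1 - d * p.2 ^+ 2.
(* [L] is the pairing of [p] with [(v, 1)] for the form [Q]: translation by [s] times [(v, 1)] fixes
   [L] and adds [2 * s * L p] to [Q]. *)
pose L (p : 'rV[F]_n.+1 * F) := dot v p.1 - d * p.2.
have total : \sum_l sphere_count n.+1 (t + d * l ^+ 2) = \sum_p (Q p == t)%:R.
  rewrite exchange_big pair_big /=; apply: eq_bigr => p _.
  by rewrite /Q subr_eq.
have off : q * (\sum_p ((L p != 0) && (Q p == t))%:R) = q ^+ n.+1 * (q - 1).
  rewrite (@shift_count _ F (fun s p => (p.1 + s *: v, p.2 + s))
    (fun p => L p != 0) (fun p => Q p == t)).
  - rewrite -(pair_big predT predT (fun x l => (L (x, l) != 0)%:R)) /=.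
    rewrite -sum_rV_one mulr_suml; apply: eq_bigr => x _; rewrite mul1r.
    rewrite -sum_one -[X in _ = _ - X](sum_affine (- dot v x) 0 d0) -sumrB.
    apply: eq_bigr => l _; rewrite subr_eq0 mulrC eq_sym.
    by rewrite /L /= subr_eq0; case: eqP.
  - by move=> s [x l] [y m] [/addIr -> /addIr ->].
  - move=> s [x l]; rewrite /L /= dot_shift dot_diag -/d; congr (_ != _); ring.
  - move=> p Lp; rewrite -[RHS](@sum_affine F (2 * L p) (Q p) t) ?mulf_neq0 //.
    apply: eq_bigr => s _; congr (_ *+ nat_of_bool (_ == _)).
    by rewrite /Q /L /= sqnorm_shift -/d; ring.
(* [L p = 0] forces [l = dot v x / d], where [Q] becomes the norm of the part of [x] orthogonal to
   [v]. This is invariant under translation by [v], which meets the hyperplane once. *)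
have on : \sum_p ((L p == 0) && (Q p == t))%:R = q * section_count v r c.
  rewrite -(pair_big predT predT
    (fun x l => ((L (x, l) == 0) && (Q (x, l) == t))%:R)) /=.
  transitivity (\sum_x (sqnorm x - dot v x ^+ 2 / d == t)%:R : rat).
    apply: eq_bigr => x _; rewrite (bigD1 (dot v x / d)) //= big1.
      rewrite addr0 /L /Q /= mulrC divfK // subrr eqxx /=.
      by congr (_ *+ nat_of_bool (_ == _)); field; rewrite d0.
    move=> l ll; rewrite (_ : L (x, l) == 0 = false) //; apply/negbTE.
    apply: contra ll; rewrite /L /= subr_eq0 => /eqP ->.
    by rewrite mulrC mulKf.
  rewrite -(@shift_count _ F (fun s x => x + s *: v)
     (fun x => sqnorm x - dot v x ^+ 2 / d == t) (fun x => dot v x == c)).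
  - congr (_ * _); apply: eq_bigr => x _; congr (_ *+ nat_of_bool _).
    rewrite andbC; case: eqP => // ->.
    by rewrite /t (inj_eq (addIr _)).
  - by move=> s; apply: addIr.
  - move=> s x; congr (_ == _); rewrite sqnorm_shift dot_shift dot_diag -/d.
    by field.
  - move=> x _; rewrite -[RHS](sum_affine (dot v x) c d0).
    apply: eq_bigr => s _; congr (_ *+ nat_of_bool (_ == _)).
    by rewrite dot_shift dot_diag addrC.
have split_L : \sum_p (Q p == t)%:R = \sum_p ((L p == 0) && (Q p == t))%:R
    + \sum_p ((L p != 0) && (Q p == t))%:R :> rat.
  rewrite -big_split; apply: eq_bigr => p _ /=.
  by case: (L p == 0); rewrite ?addr0 ?add0r.
have {}off : \sum_p ((L p != 0) && (Q p == t))%:R = q ^+ n * (q - 1).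
  by apply: (mulfI (lt0r_neq0 q0)); rewrite off exprS; ring.
rewrite /sphere_err sumrB total split_L on off sumr_const -mulr_natr; ring.
Qed.

(** The isotropic case uses the pointwise bound of [small_err] at [r]. The anisotropic case uses the
    averaged bound, whose base point [r - c ^+ 2 / sqnorm v] may vanish. *)
Lemma section_count_le n (v : 'rV[F]_n.+2) r c : v != 0 -> r != 0 ->
  section_count v r c <= q ^+ n + q ^+ (n.+1 %/ 2).
Proof.
move=> v0 r0; have q0 := q_gt0.
have [err1 err2] := small_sphere_err n.+1.
have [nv|nv] := eqVneq (sqnorm v) 0.
  have [->|c0] := eqVneq c 0.
    rewrite section_count_isotropic0 // lerD2l.
    exact: le_trans (ler_norm _) (err1 _ r0).
  by rewrite section_count_isotropic_neq0 // lerDl exprn_ge0 // ltW.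
rewrite -(ler_pM2l q0) section_count_anisotropic // mulrDr -exprS lerD2l.
exact: le_trans (ler_norm _) (err2 _ _ nv).
Qed.

(** * Sizes of spheres and of their pairwise intersections *)

Lemma card_sphere_ge n (a : 'rV[F]_n.+1) r : r != 0 ->
  q ^+ n - q ^+ (n %/ 2) <= #|sphere a r|%:R.
Proof.
move=> r0; have [/(_ r r0) + _] := small_sphere_err n.
rewrite [#|sphere _ _|%:R]natr_card ler_norml /sphere_err => /andP[+ _].
rewrite (_ : sphere_count _ _ = \sum_x (x \in sphere a r)%:R).
  by lra. 
rewrite [RHS](reindex_inj (addIr a)); apply: eq_bigr => x _.
by rewrite inE addrK.
Qed.

Lemma card_sphereI_le n (S T : {set 'rV[F]_n.+2}) :
  is_sphere S -> is_sphere T -> S != T ->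
  #|S :&: T|%:R <= q ^+ n + q ^+ (n.+1 %/ 2).
Proof.
move=> /existsP[a /existsP[r /andP[r0 /eqP ->]]].
move=> /existsP[b /existsP[s /andP[s0 /eqP ->]]] neq.
(* Distinct concentric spheres have different radii and are disjoint. *)
have [ab|ab] := eqVneq a b.
  have rs : r != s by apply: contra neq => /eqP ->; rewrite ab.
  rewrite (_ : _ :&: _ = set0) ?cards0 ?addr_ge0 ?exprn_ge0 ?ler0n //.
  apply/setP => x; rewrite !inE ab; case: eqP => // -> /=.
  exact: negbTE.
pose v := b - a; have v0 : v != 0 by rewrite subr_eq0 eq_sym.
(* With [a] moved to the origin, subtracting [sqnorm (x - v) = s] from [sqnorm x = r] leaves a
   linear equation, whose constant is the one given here. *)
apply: le_trans (section_count_le ((r - s + sqnorm v) / 2) v0 r0).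
rewrite [#|_ :&: _|%:R]natr_card (reindex_inj (addIr a)); apply: ler_sum => x _.
rewrite !inE addrK (_ : x + a - b = x + (-1) *: v); last first.
  by rewrite scaleN1r opprB addrA.
rewrite sqnorm_shift; have [->|] := eqVneq (sqnorm x) r; last by rewrite andbF.
rewrite andbT ler_nat; case: eqP => // H.
suff -> : dot v x = (r - s + sqnorm v) / 2 by rewrite eqxx.
by rewrite -H; field.
Qed.

End OddField.

(** * Bonferroni bound and conclusion *)

(** Adding a set to [k] others gains at least [A - k * B] points; summing over [k] from 0 to
    [size s - 1] gives the bound. *)
Lemma bonferroni (T : finType) (A B : rat) (s : seq {set T}) :
  0 <= B -> uniq s -> {in s, forall S : {set T}, A <= #|S|%:R} ->
  {in s &, forall S S' : {set T}, S != S' -> #|S :&: S'|%:R <= B} ->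
  (size s)%:R * A - (size s)%:R * ((size s)%:R - 1) / 2 * B
    <= #|\bigcup_(S <- s) S|%:R.
Proof.
move=> B0; elim: s => [|S s IH] /=; first by rewrite !mul0r subr0 ler0n.
move=> /andP[Ss us] hA hB; rewrite big_cons.
have {}IH := IH us (fun S' h => hA S' (mem_behead (s := S :: s) h))
  (fun S1 S2 h1 h2 => hB S1 S2 (mem_behead (s := S :: s) h1)
     (mem_behead (s := S :: s) h2)).
have hS := hA S (mem_head _ _).
have cap : #|S :&: \bigcup_(S' <- s) S'|%:R <= (size s)%:R * B.
  have : {in s, forall S' : {set T}, #|S :&: S'|%:R <= B}.
    move=> S' S's; apply: hB; rewrite ?mem_head // ?inE ?S's ?orbT //.
    by apply: contraNneq Ss => ->.
  elim: s {IH us hA hB Ss} => [|S' s IH] /= h.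
    by rewrite big_nil setI0 cards0 mul0r.
  rewrite big_cons setIUr -natr1 mulrDl mul1r addrC.
  apply: le_trans (_ : (#|S :&: S'| + #|S :&: \bigcup_(j <- s) j|)%:R <= _).
    by rewrite ler_nat cardsU leq_subr.
  rewrite natrD lerD ?h ?mem_head // IH // => S2 hS2.
  by apply: h; rewrite inE hS2 orbT.
have := cardsUI S (\bigcup_(S' <- s) S').
move=> /(congr1 (fun k => k%:R : rat)); rewrite !natrD -natr1.
move: IH hS cap; set k := (size s)%:R; set U := #|S :|: _|%:R.
set I := #|S :&: _|%:R; set V := #|\bigcup_(_ <- _) _|%:R => *; nra.
Qed.

Theorem theorem1p1 (p k q n : nat) (F : finFieldType) (K : {set 'rV[F]_n})
    (hp : prime p) (hodd : odd p) (hk : (0 < k)%N) (hq : q = (p ^ k)%N)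
    (hF : #|F| = q) (hn : (2 <= n)%N)
    (hK : ((if (4 <= n)%N then q - 1 else (q - 1) %/ 2) <= #|spheres_in K|)%N) :
  (if (4 <= n)%N then
     1 / 2 * q%:R ^+ n + 1 / 2 * q%:R ^+ (n - 1) - q%:R ^+ (n - 2)
     - 1 / 2 * q%:R ^+ ((n - 1) %/ 2 + 2)
     + 1 / 2 * q%:R ^+ ((n - 1) %/ 2 + 1)
   else (q%:R ^+ n - q%:R ^+ (n - 2)) / 4)
  <= #|K|%:R :> rat.
Proof.
have oddq : odd q by rewrite hq oddX hodd orbT.
have two : 2 != 0 :> F.
  have /pcharf0 p0 : p \in [pchar F] by apply: card_finPcharP hp; rewrite hF hq.
  (* If 2 vanished in [F], the odd number [p] would equal 1 there, but [p] is the characteristic. *)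
  apply/eqP => F2; move: p0; rewrite -(odd_double_half p) hodd -muln2 natrD natrM.
  by rewrite F2 mulr0 addr0 => /eqP; rewrite oner_eq0.
case: n hn K hK => [|[|n]] // _ K.
set m := (X in (X <= _)%N); set f := (n.+1 %/ 2)%N.
move=> hm; set A : rat := q%:R ^+ n.+1 - q%:R ^+ f.
set B : rat := q%:R ^+ n + q%:R ^+ f.
have B0 : 0 <= B by rewrite addr_ge0 ?exprn_ge0 ?ler0n.
suff : m%:R * A - m%:R * (m%:R - 1) / 2 * B <= #|K|%:R.
  apply: le_trans.
  rewrite /m /A /B {m hm A B B0} !subSS !subn0 {}/f.
  have q1 : (1 < q)%N by rewrite -hF finRing_gt1.
  case: ifP => n4.
    rewrite addn2 addn1 natrB ?(ltnW q1) // !exprS; lra.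
  (* The truncated division is exact because [q] is odd. *)
  have -> : ((q - 1) %/ 2)%:R = (q%:R - 1) / 2 :> rat.
    rewrite (_ : q%:R = ((q - 1) %/ 2)%:R * 2 + 1 :> rat) ?addrK ?mulfK //.
    by rewrite -natrM natr1; congr (_%:R); move: oddq q1; lia.
  (* Only dimensions 2 and 3 remain, where the exponent [f] is 0 and 1. *)
  by case: n n4 {K} => [|[|n]] //= _; rewrite !exprS expr0; lra.
(* Exactly [m] spheres are kept: the Bonferroni bound is quadratic in the number of sets and
   eventually decreases, so surplus spheres could weaken it. *)
pose s := take m (enum (spheres_in K)).
have sK S : S \in s -> is_sphere S /\ S \subset K.
  by move=> /mem_take; rewrite mem_enum inE => /andP.
have sm : size s = m by rewrite size_take_min -cardE; apply/minn_idPl.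
rewrite -sm.
apply: le_trans (bonferroni (A := A) (B := B) B0 _ _ _) _.
- exact: take_uniq (enum_uniq _).
- move=> S /sK[/existsP[a /existsP[r /andP[r0 /eqP ->]]] _].
  by rewrite /A -hF; apply: card_sphere_ge.
- by move=> S T /sK[hS _] /sK[hT _] ST; rewrite /B -hF; apply: card_sphereI_le.
rewrite ler_nat; apply: subset_leq_card.
by rewrite bigcup_seq; apply/bigcupsP => S /sK[].
Qed.
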